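(* Let $L$ be a Hausdorff precompact co-Heyting algebra, and identify $L$ with its image in $\widehat L$ under the diagonal map $a\mapsto(\pi_d(a))_{d<\omega}$. Then for every positive integer $d$: (1) the ideals $dL$ and $d\widehat L$ are principal and $\varepsilon_d(L)=\varepsilon_d(\widehat L)$; (2) the closure of $dL$ in $\widehat L$ (for the projective topology) is $d\widehat L$, and the inclusion $L\subseteq\widehat L$ induces an isomorphism $L/dL\cong\widehat L/d\widehat L$. Consequently the projective topology on $\widehat L$ coincides with its codimetric topology, and $(\widehat L,\operatorname{dist}_{\widehat L})$ is the completion of the metric space $(L,\operatorname{dist}_L)$.
   Context: A co-Heyting algebra is a bounded distributive lattice $(L,0,1,\vee,\wedge)$ such that $a-b=\min\{c\in L: a\le b\vee c\}$ exists for all $a,b$. Let $a\triangle b=(a-b)\vee(b-a)$; for an ideal $I$, $L/I$ is the quotient by $a\equiv_I b\iff a\triangle b\in I$. $\operatorname{Spec}L$ is the set of prime filters ordered by inclusion; height = foundation rank there; $\operatorname{codim}_La=\min\{\operatorname{height}\mathfrak p: a\in\mathfrak p\}$ ($+\infty$ if none); $dL=\{a:\operatorname{codim}_La\ge d\}$ is an ideal, and $\varepsilon_d(L)$ denotes its generator when principal. $\pi_d:L\to L/dL$ is the canonical projection, and since $(d+1)L\subseteq dL$ there is a canonical surjection $\pi_{d,d+1}:L/(d+1)L\to L/dL$. $\widehat L=\{(x_d)_{d<\omega}: x_d\in L/dL,\ \pi_{d,d+1}(x_{d+1})=x_d\}$ is the projective limit, a co-Heyting algebra (subalgebra of the product),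 with the projective topology induced by the discrete topologies on the $L/dL$. The codimetric pseudometric of a co-Heyting algebra $M$ is $\operatorname{dist}_M(a,b)=2^{-\operatorname{codim}_M(a\triangle b)}$ if finite, $0$ otherwise; the codimetric topology is the topology it defines. $L$ is Hausdorff if every nonzero element has finite codimension; $L$ is precompact if $L/dL$ is finite for every positive integer $d$. *)

(* Defs.v *)
(* Co-Heyting algebras, presented as "setoid signatures":
   a carrier type, a domain predicate [mem] (the underlying set), an
   equivalence [eqv] (the equality of the algebra), and the operations.
   This lets quotients L/I and the projective limit \hat L be presented
   literally (representatives + equivalence, subset of a product). *)
From Stdlib Require Import Reals Arith List ClassicalEpsilon.
Set Implicit Arguments.

Record CHSig := mkCHSig {
  car  : Type;
  mem  : car -> Prop;
  eqv  : car -> car -> Prop;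
  join : car -> car -> car;
  meet : car -> car -> car;
  sub  : car -> car -> car;
  bot  : car;
  top  : car }.

Arguments mem {c} _.
Arguments eqv {c} _ _.
Arguments join {c} _ _.
Arguments meet {c} _ _.
Arguments sub {c} _ _.

Definition le (S : CHSig) (a b : car S) : Prop := eqv (join a b) b.
Arguments le {S} a b.

Definition symdiff (S : CHSig) (a b : car S) : car S := join (sub a b) (sub b a).
Arguments symdiff {S} a b.

Definition is_coHeyting (S : CHSig) : Prop :=
  (forall a : car S, mem a -> eqv a a) /\
  (forall a b : car S, mem a -> mem b -> eqv a b -> eqv b a) /\
  (forall a b c : car S, mem a -> mem b -> mem c -> eqv a b -> eqv b c -> eqv a c) /\
  mem (bot S) /\ mem (top S) /\
  (forall a b : car S, mem a -> mem b ->
     mem (join a b) /\ mem (meet a b) /\ mem (sub a b)) /\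
  (forall a a' b b' : car S, mem a -> mem a' -> mem b -> mem b' ->
     eqv a a' -> eqv b b' ->
     eqv (join a b) (join a' b') /\ eqv (meet a b) (meet a' b') /\
     eqv (sub a b) (sub a' b')) /\
  (forall a b : car S, mem a -> mem b -> eqv (join a b) (join b a) /\ eqv (meet a b) (meet b a)) /\
  (forall a b c : car S, mem a -> mem b -> mem c ->
     eqv (join a (join b c)) (join (join a b) c) /\
     eqv (meet a (meet b c)) (meet (meet a b) c)) /\
  (forall a b : car S, mem a -> mem b ->
     eqv (join a (meet a b)) a /\ eqv (meet a (join a b)) a) /\
  (forall a : car S, mem a -> eqv (join a (bot S)) a /\ eqv (meet a (top S)) a) /\
  (forall a b c : car S, mem a -> mem b -> mem c ->
     eqv (meet a (join b c)) (join (meet a b) (meet a c))) /\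
  (forall a b : car S, mem a -> mem b ->
     le a (join b (sub a b)) /\
     (forall c : car S, mem c -> le a (join b c) -> le (sub a b) c)).

Definition prime_filter (S : CHSig) (p : car S -> Prop) : Prop :=
  (forall a : car S, p a -> mem a) /\
  p (top S) /\ ~ p (bot S) /\
  (forall a b : car S, mem b -> p a -> le a b -> p b) /\
  (forall a b : car S, p a -> p b -> p (meet a b)) /\
  (forall a b : car S, mem a -> mem b -> p (join a b) -> p a \/ p b).

Definition strict_incl (S : CHSig) (q p : car S -> Prop) : Prop :=
  (forall a, q a -> p a) /\ exists a, p a /\ ~ q a.
Arguments strict_incl {S} q p.

(* height_ge S p n  <->  the foundation rank of p in (Spec S, ⊆) is >= n *)
Fixpoint height_ge (S : CHSig) (p : car S -> Prop) (n : nat) : Prop :=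
  match n with
  | 0 => True
  | Datatypes.S m => exists q, prime_filter S q /\ strict_incl q p /\ height_ge S q m
  end.

(* codim_S a >= n  (codim = min of heights of prime filters containing a,
   +oo if there is none) *)
Definition codim_ge (S : CHSig) (a : car S) (n : nat) : Prop :=
  forall p, prime_filter S p -> p a -> height_ge S p n.

Definition codim_eq (S : CHSig) (a : car S) (n : nat) : Prop :=
  codim_ge S a n /\ ~ codim_ge S a (Datatypes.S n).

Definition dideal (S : CHSig) (d : nat) (a : car S) : Prop :=
  mem a /\ codim_ge S a d.

Definition principal_gen (S : CHSig) (I : car S -> Prop) (g : car S) : Prop :=
  mem g /\ forall a : car S, mem a -> (I a <-> le a g).

Definition quot (S : CHSig) (I : car S -> Prop) : CHSig :=
  @mkCHSig (car S) (@mem S) (fun a b => I (symdiff a b))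
           (@join S) (@meet S) (@sub S) (bot S) (top S).

Definition eqmod (S : CHSig) (d : nat) (a b : car S) : Prop :=
  dideal S d (symdiff a b).

(* \hat S = { (x_d)_d : x_d \in S/dS, pi_{d,d+1}(x_{d+1}) = x_d },
   a subalgebra of the product of the S/dS *)
Definition hat (S : CHSig) : CHSig :=
  @mkCHSig (nat -> car S)
    (fun x => (forall d, mem (x d)) /\ (forall d, eqmod S d (x (Datatypes.S d)) (x d)))
    (fun x y => forall d, eqmod S d (x d) (y d))
    (fun x y d => join (x d) (y d))
    (fun x y d => meet (x d) (y d))
    (fun x y d => sub (x d) (y d))
    (fun _ => bot S) (fun _ => top S).

Definition diag (S : CHSig) (a : car S) : car (hat S) := fun _ => a.

Definition is_iso (S1 S2 : CHSig) (f : car S1 -> car S2) : Prop :=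
  (forall a : car S1, mem a -> mem (f a)) /\
  (forall a b : car S1, mem a -> mem b -> (eqv (f a) (f b) <-> eqv a b)) /\
  (forall y : car S2, mem y -> exists a, mem a /\ eqv (f a) y) /\
  (forall a b : car S1, mem a -> mem b ->
     eqv (f (join a b)) (join (f a) (f b)) /\
     eqv (f (meet a b)) (meet (f a) (f b)) /\
     eqv (f (sub a b)) (sub (f a) (f b))) /\
  eqv (f (bot S1)) (bot S2) /\ eqv (f (top S1)) (top S2).

Definition proj_closure_img (S : CHSig) (A : car S -> Prop) (x : car (hat S)) : Prop :=
  forall n, exists a, A a /\ forall k, k <= n -> eqmod S k a (x k).
Arguments proj_closure_img {S} A x.

Definition proj_open (S : CHSig) (U : car (hat S) -> Prop) : Prop :=
  forall x : car (hat S), mem x -> U x ->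
    exists n, forall y : car (hat S), mem y -> (forall k, k <= n -> eqmod S k (y k) (x k)) -> U y.
Arguments proj_open {S} U.

Definition dist (S : CHSig) (a b : car S) : R :=
  match excluded_middle_informative (exists n, codim_eq S (symdiff a b) n) with
  | left h => (/ 2) ^ (proj1_sig (constructive_indefinite_description _ h))
  | right _ => 0
  end.

Definition dist_open (S : CHSig) (U : car S -> Prop) : Prop :=
  forall x : car S, mem x -> U x ->
    exists eps, (0 < eps)%R /\ forall y : car S, mem y -> (dist S x y < eps)%R -> U y.
Arguments dist_open {S} U.

Definition cauchy (S : CHSig) (s : nat -> car S) : Prop :=
  forall eps, (0 < eps)%R -> exists N, forall m n, N <= m -> N <= n ->
    (dist S (s m) (s n) < eps)%R.

Definition converges_to (S : CHSig) (s : nat -> car S) (x : car S) : Prop :=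
  forall eps, (0 < eps)%R -> exists N, forall n, N <= n -> (dist S (s n) x < eps)%R.

Definition is_completion_via_diag (S : CHSig) : Prop :=
  (forall a b : car S, mem a -> mem b -> dist S a b = 0%R -> eqv a b) /\
  (forall x y : car (hat S), @mem (hat S) x -> @mem (hat S) y -> dist (hat S) x y = 0%R ->
     @eqv (hat S) x y) /\
  (forall a : car S, mem a -> @mem (hat S) (diag S a)) /\
  (forall a b : car S, mem a -> mem b -> dist (hat S) (diag S a) (diag S b) = dist S a b) /\
  (forall x : car (hat S), @mem (hat S) x -> forall eps, (0 < eps)%R ->
     exists a, mem a /\ (dist (hat S) (diag S a) x < eps)%R) /\
  (forall s : nat -> car (hat S), (forall n, @mem (hat S) (s n)) -> cauchy (hat S) s ->
     exists x, @mem (hat S) x /\ converges_to (hat S) s x).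

Definition CHofType (T : Type) (j m s : T -> T -> T) (b t : T) : CHSig :=
  @mkCHSig T (fun _ => True) (@eq T) j m s b t.

Definition hausdorff (S : CHSig) : Prop :=
  forall a : car S, mem a -> ~ eqv a (bot S) -> exists n, ~ codim_ge S a n.

Definition precompact (S : CHSig) : Prop :=
  forall d, 1 <= d -> exists l : list (car S),
    (forall b, In b l -> mem b) /\
    forall a : car S, mem a -> exists b, In b l /\ eqmod S d a b.

(* Main.v *)
(** In a co-Heyting algebra, [a - b] belongs to a prime [p] iff some prime [q] contained in [p]
    contains [a] and not [b]. Hence [a] and [b] agree modulo [dL] iff they agree on all primes
    of height [< d], and when [L/dL] is finite a prime contains the generator [g_d] of [dL]
    iff its height is at least [d]. Separation by primes of finite height gives
    [g_d - g_{d+1} = g_d] in [L]. This identity persists in the limit, so that a prime of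
    the limit containing [g_d] has height at least [d]; a prime avoiding [g_d] is
    determined by its trace on [L], which bounds its height by that of the trace. Thus
    [x] has codimension at least [d] in the limit iff [x_d] lies in [dL], and everything
    follows from this equivalence. *)

Require Import Defs.
From Stdlib Require Import Reals Arith List Lia Lra Classical ClassicalEpsilon.
From mathcomp Require classical_sets.
Set Implicit Arguments.
Unset Strict Implicit.

(** * Co-Heyting algebras in order form *)

(** These inequalities can be checked both in [L], where [eqv] is equality, and in the limit, where
    it is coordinatewise congruence, so each lemma about primes serves both algebras. *)
Record co_Heyting_order (S : CHSig) : Prop := {
  mem_bot : mem (bot S);
  mem_top : mem (top S);
  mem_join : forall a b : car S, mem a -> mem b -> mem (join a b);
  mem_meet : forall a b : car S, mem a -> mem b -> mem (meet a b);
  mem_sub : forall a b : car S, mem a -> mem b -> mem (sub a b);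
  le_refl : forall a : car S, mem a -> le a a;
  le_trans : forall a b c : car S, mem a -> mem b -> mem c ->
    le a b -> le b c -> le a c;
  le_antisym : forall a b : car S, mem a -> mem b -> le a b -> le b a -> eqv a b;
  eqv_le : forall a b : car S, mem a -> mem b -> eqv a b -> le a b;
  bot_le : forall a : car S, mem a -> le (bot S) a;
  le_top : forall a : car S, mem a -> le a (top S);
  le_join_l : forall a b : car S, mem a -> mem b -> le a (join a b);
  le_join_r : forall a b : car S, mem a -> mem b -> le b (join a b);
  join_lub : forall a b c : car S, mem a -> mem b -> mem c ->
    le a c -> le b c -> le (join a b) c;
  meet_le_l : forall a b : car S, mem a -> mem b -> le (meet a b) a;
  meet_le_r : forall a b : car S, mem a -> mem b -> le (meet a b) b;
  meet_glb : forall a b c : car S, mem a -> mem b -> mem c ->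
    le c a -> le c b -> le c (meet a b);
  meet_join_distr : forall a b c : car S, mem a -> mem b -> mem c ->
    le (meet a (join b c)) (join (meet a b) (meet a c));
  le_join_sub : forall a b : car S, mem a -> mem b -> le a (join b (sub a b));
  sub_le : forall a b c : car S, mem a -> mem b -> mem c ->
    le a (join b c) -> le (sub a b) c }.

Record is_ideal (S : CHSig) (I : car S -> Prop) : Prop := {
  ideal_mem : forall a, I a -> mem a;
  ideal_bot : I (bot S);
  ideal_down : forall a b, mem a -> I b -> le a b -> I a;
  ideal_join : forall a b, I a -> I b -> I (join a b) }.

Global Hint Resolve mem_bot mem_top mem_join mem_meet mem_sub le_refl bot_le le_top
  le_join_l le_join_r meet_le_l meet_le_r : coH.

(** * Prime filters: existence and behaviour on differences *)

Section PrimeFilters.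

Variable S : CHSig.
Hypothesis HS : co_Heyting_order S.

Local Ltac mm := auto 8 with coH.

Lemma join_mono (a b c d : car S) : mem a -> mem b -> mem c -> mem d ->
  le a c -> le b d -> le (join a b) (join c d).
Proof.
  intros. apply (join_lub HS); mm.
  - apply (le_trans HS) with c; mm.
  - apply (le_trans HS) with d; mm.
Qed.

(** The dual distributive law, from two uses of [meet_join_distr]. It makes the complement of a
    maximal ideal closed under meets. *)
Lemma le_join_meet (a c x y : car S) : mem a -> mem c -> mem x -> mem y ->
  le a (join c x) -> le a (join c y) -> le a (join c (meet x y)).
Proof.
  intros Ha Hc Hx Hy H1 H2.
  apply (le_trans HS) with (meet a (join c y)); mm.
  - apply (meet_glb HS); mm.
  - apply (le_trans HS) with (join (meet a c) (meet a y)); mm.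
    + apply (meet_join_distr HS); mm.
    + apply (join_lub HS); mm.
      * apply (le_trans HS) with c; mm.
      * apply (le_trans HS) with (meet y (join c x)); mm.
        { apply (meet_glb HS); mm.
          apply (le_trans HS) with a; mm. }
        apply (le_trans HS) with (join (meet y c) (meet y x)); mm.
        { apply (meet_join_distr HS); mm. }
        apply join_mono; mm. apply (meet_glb HS); mm.
Qed.

(* A maximal ideal among those containing [I] and avoiding [a] has a prime complement. *)
Lemma prime_filter_avoiding (I : car S -> Prop) (a : car S) :
  is_ideal I -> mem a -> ~ I a ->
  exists q, prime_filter S q /\ q a /\ forall x, I x -> ~ q x.
Proof.
  intros HI Ha HIa.
  (* The ideal is [I] together with [X], not [X] alone, so that the union of the empty chain still
     satisfies [P]. *)
  set (P := fun X : car S -> Prop =>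
    is_ideal (fun x => I x \/ X x) /\ ~ X a).
  destruct (@classical_sets.Zorn_bigcup (car S) P) as [A [[HA HAa] Amax]].
  { intros F HF Ftot. split.
    2: { intros [X FX Xa]. exact (proj2 (HF X FX) Xa). }
    constructor.
    - intros x [Ix | [X FX Xx]]. { exact (ideal_mem HI Ix). }
      exact (ideal_mem (proj1 (HF X FX)) (or_intror Xx)).
    - left. exact (ideal_bot HI).
    - intros x y Hx [Iy | [X FX Xy]] Hxy.
      { left. exact (ideal_down HI Hx Iy Hxy). }
      destruct (ideal_down (proj1 (HF X FX)) Hx (or_intror Xy) Hxy) as [h | h].
      { left; exact h. }
      right. exists X; assumption.
    - assert (one : forall X x y, F X -> (I x \/ X x) -> (I y \/ X y) ->
        I (join x y) \/ classical_sets.bigcup F (fun X => X) (join x y)).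
      { intros X x y FX hx hy.
        destruct (ideal_join (proj1 (HF X FX)) hx hy) as [h | h].
        { left; exact h. }
        right. exists X; assumption. }
      intros x y [Ix | [X FX Xx]] [Iy | [Y FY Yy]].
      + left. exact (ideal_join HI Ix Iy).
      + apply (one Y); auto.
      + apply (one X); auto.
      + destruct (Ftot X Y FX FY) as [h | h].
        * apply (one Y); auto.
        * apply (one X); auto. }
  set (J := fun x => I x \/ A x) in *.
  assert (HJa : ~ J a) by (intros [h | h]; auto).
  (* [B] below is the ideal generated by [J] and [x]; it strictly contains [A], so maximality puts
     [a] in it. *)
  assert (key : forall x, mem x -> ~ J x -> exists c, J c /\ le a (join c x)).
  { intros x Hx HJx.
    set (B := fun z => mem z /\ exists c, J c /\ le z (join c x)).
    assert (JB : forall z, J z -> B z).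
    { intros z Jz. pose proof (ideal_mem HA Jz). split; [assumption|].
      exists z. split; mm. }
    assert (Bx : B x).
    { split; [assumption|]. exists (bot S). split. { exact (ideal_bot HA). } mm. }
    assert (HB : ~ P B).
    { apply Amax. split.
      - intros z Az. apply JB. right; exact Az.
      - intros h. apply HJx. right. exact (h x Bx). }
    destruct (classic (B a)) as [[_ h] | nBa]; [exact h|].
    exfalso. apply HB. split; [|exact nBa].
    assert (toB : forall z, I z \/ B z -> B z).
    { intros z [h | h]; auto. apply JB. left; exact h. }
    constructor.
    - intros z hz. exact (proj1 (toB z hz)).
    - left. exact (ideal_bot HI).
    - intros y z Hy hz Hyz. right.
      destruct (toB z hz) as [Hz [c [Jc Hc]]].
      pose proof (ideal_mem HA Jc).
      split; [assumption|]. exists c. split; [assumption|].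
      apply (le_trans HS) with z; mm.
    - intros y z hy hz. right.
      destruct (toB y hy) as [Hy [c [Jc Hc]]].
      destruct (toB z hz) as [Hz [d [Jd Hd]]].
      pose proof (ideal_mem HA Jc). pose proof (ideal_mem HA Jd).
      split; [mm|]. exists (join c d). split; [exact (ideal_join HA Jc Jd)|].
      apply (join_lub HS); mm.
      + apply (le_trans HS) with (join c x); mm. apply join_mono; mm.
      + apply (le_trans HS) with (join d x); mm. apply join_mono; mm. }
  exists (fun x => mem x /\ ~ J x).
  split; [|split].
  - split; [|split; [|split; [|split; [|split]]]].
    + intros x h. apply h.
    + split; [mm|]. intros h. apply HJa. apply (ideal_down HA) with (top S); mm.
    + intros [_ h]. apply h. exact (ideal_bot HA).
    + intros x y Hy [Hx hx] Hxy. split; [assumption|]. intros h. apply hx.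
      exact (ideal_down HA Hx h Hxy).
    + intros x y [Hx hx] [Hy hy]. split; [mm|]. intros h.
      destruct (key x Hx hx) as [c [Jc Hc]].
      destruct (key y Hy hy) as [d [Jd Hd]].
      pose proof (ideal_mem HA Jc). pose proof (ideal_mem HA Jd).
      apply HJa. apply (ideal_down HA) with (join (join c d) (meet x y)); mm.
      { apply (ideal_join HA); auto. apply (ideal_join HA); auto. }
      apply le_join_meet; mm.
      * apply (le_trans HS) with (join c x); mm. apply join_mono; mm.
      * apply (le_trans HS) with (join d y); mm. apply join_mono; mm.
    + intros x y Hx Hy [_ h]. apply NNPP. intros nh. apply h.
      apply (ideal_join HA); apply NNPP; intros k; apply nh; [left | right]; auto.
  - auto.
  - intros x Ix [_ h]. apply h. left; exact Ix.
Qed.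

Lemma prime_join_iff (p : car S -> Prop) (a b : car S) :
  prime_filter S p -> mem a -> mem b -> (p (join a b) <-> p a \/ p b).
Proof.
  intros (Hm & Ht & Hb & Hup & Hmt & Hj) Ha Hb'. split; [apply Hj; auto|].
  intros [h | h]; eapply Hup; try exact h; mm.
Qed.

Lemma prime_meet_iff (p : car S -> Prop) (a b : car S) :
  prime_filter S p -> mem a -> mem b -> (p (meet a b) <-> p a /\ p b).
Proof.
  intros (Hm & Ht & Hb & Hup & Hmt & Hj) Ha Hb'. split.
  - intros h. split; eapply Hup; try exact h; mm.
  - intros [h k]. auto.
Qed.

(** The elements below some [join b e] with [e] outside [p] form an ideal. It omits [a], since
    otherwise [sub a b], a member of [p], would be below such an [e]. A prime containing [a] and
    avoiding this ideal lies in [p] and omits [b]. The converse uses that [a] is below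
    [join b (sub a b)]. *)
Lemma prime_sub_iff (p : car S -> Prop) (a b : car S) :
  prime_filter S p -> mem a -> mem b ->
  (p (sub a b) <->
   exists q, prime_filter S q /\ (forall x, q x -> p x) /\ q a /\ ~ q b).
Proof.
  intros Hp Ha Hb. pose proof Hp as (Hm & Ht & Hbt & Hup & Hmt & Hj). split.
  - intros h.
    set (I := fun x => mem x /\ exists e, mem e /\ ~ p e /\ le x (join b e)).
    assert (HI : is_ideal I).
    { constructor.
      - intros x hx; apply hx.
      - split; [mm|]. exists (bot S). repeat split; mm.
      - intros x y Hx [Hy [e [He [pe ye]]]] xy. split; [assumption|].
        exists e. repeat split; mm. apply (le_trans HS) with y; mm.
      - intros x y [Hx [e [He [pe xe]]]] [Hy [f [Hf [pf yf]]]]. split; [mm|].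
        exists (join e f). repeat split; mm.
        { intros k. destruct (Hj e f He Hf k); auto. }
        apply (join_lub HS); mm.
        + apply (le_trans HS) with (join b e); mm. apply join_mono; mm.
        + apply (le_trans HS) with (join b f); mm. apply join_mono; mm. }
    destruct (@prime_filter_avoiding I a HI Ha) as [q [Hq [qa qI]]].
    { intros [_ [e [He [pe ae]]]]. apply pe. apply (Hup (sub a b)); auto.
      apply (sub_le HS); mm. }
    exists q. split; [assumption|]. split; [|split; [assumption|]].
    + intros x qx. pose proof (proj1 Hq x qx). apply NNPP. intros px.
      apply (qI x); auto. split; [assumption|]. exists x. repeat split; mm.
    + apply qI. split; [assumption|]. exists (bot S). repeat split; mm.
  - intros [q [Hq [qp [qa qb]]]].
    destruct (proj1 (@prime_join_iff q b (sub a b) Hq Hb (mem_sub HS Ha Hb))).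
    + destruct Hq as (_ & _ & _ & Uq & _). apply (Uq a); mm. apply (le_join_sub HS); mm.
    + contradiction.
    + auto.
Qed.

Lemma mem_symdiff (a b : car S) : mem a -> mem b -> mem (symdiff a b).
Proof. unfold symdiff. mm. Qed.

Lemma prime_up (p : car S -> Prop) (a b : car S) :
  prime_filter S p -> mem b -> le a b -> p a -> p b.
Proof. intros (_ & _ & _ & U & _) Hb Hab pa. exact (U a b Hb pa Hab). Qed.

Lemma prime_symdiff_iff (p : car S -> Prop) (a b : car S) :
  prime_filter S p -> mem a -> mem b ->
  (p (symdiff a b) <->
   exists q, prime_filter S q /\ (forall x, q x -> p x) /\ ~ (q a <-> q b)).
Proof.
  intros Hp Ha Hb. unfold symdiff.
  rewrite prime_join_iff, !prime_sub_iff by mm. split.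
  - intros [[q (Hq & qp & h & k)] | [q (Hq & qp & h & k)]]; exists q; tauto.
  - intros [q (Hq & qp & h)]. destruct (classic (q a)); [left | right]; exists q; tauto.
Qed.

(** For use with [c] a generator of [dL]: primes avoiding it cannot separate elements congruent
    modulo [dL]. *)
Lemma prime_congr (p : car S -> Prop) (a b c : car S) :
  prime_filter S p -> mem a -> mem b -> mem c -> le (symdiff a b) c -> ~ p c ->
  (p a <-> p b).
Proof.
  intros Hp Ha Hb Hc Hle Hpc. apply NNPP. intros h. apply Hpc.
  apply (prime_up Hp Hc Hle). apply prime_symdiff_iff; auto. exists p; auto.
Qed.

End PrimeFilters.

(** * Height, codimension and the codimetric distance *)

Section Height.

Variable S : CHSig.

Lemma height_ge_le (p : car S -> Prop) (m n : nat) :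
  m <= n -> height_ge S p n -> height_ge S p m.
Proof.
  revert p n. induction m as [|m IH]; intros p n Hmn H; [exact I|].
  destruct n as [|n]; [lia|]. destruct H as [q [Hq [qp H]]].
  exists q. split; [assumption|]. split; [assumption|]. apply IH with n; [lia | assumption].
Qed.

Lemma codim_ge_le (a : car S) (m n : nat) :
  m <= n -> codim_ge S a n -> codim_ge S a m.
Proof. intros Hmn H p Hp pa. apply height_ge_le with n; auto. Qed.

Lemma height_ge_mono (p q : car S -> Prop) (n : nat) :
  (forall x, p x -> q x) -> height_ge S p n -> height_ge S q n.
Proof.
  intros pq. destruct n as [|n]; [trivial|]. intros [r [Hr [[rp [x [px rx]]] H]]].
  exists r. split; [assumption|]. split; [split; eauto | assumption].
Qed.

Lemma height_ge_succ_of_subset (p q : car S -> Prop) (n : nat) (x : car S) :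
  prime_filter S q -> (forall y, q y -> p y) -> p x -> ~ q x ->
  height_ge S q n -> height_ge S p (Datatypes.S n).
Proof.
  intros Hq qp px qx H. exists q. split; [assumption|]. split; [|assumption].
  split; [assumption|]. exists x; auto.
Qed.

(** While the height exceeds [d], pass to a strictly smaller prime of height at least [d]; the bound
    [n] drops by one each time, so the descent stops. *)
Lemma subset_of_exact_height (q : car S -> Prop) (d n : nat) :
  prime_filter S q -> ~ height_ge S q n -> height_ge S q d ->
  exists r, prime_filter S r /\ (forall x, r x -> q x) /\
    height_ge S r d /\ ~ height_ge S r (Datatypes.S d).
Proof.
  revert q. induction n as [|n IH]; intros q Hq Hn Hd; [destruct (Hn I)|].
  destruct (classic (height_ge S q (Datatypes.S d))) as [[r [Hr [[rq Hx] Hrd]]] | H].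
  - assert (Hrn : ~ height_ge S r n).
    { intros k. apply Hn. exists r. split; [|split; [split|]]; assumption. }
    destruct (IH r Hr Hrn Hrd) as [r' [Hr' [r'r Hh]]].
    exists r'. split; [assumption|]. split; auto.
  - exists q. auto.
Qed.

Lemma codim_exact (a : car S) (n : nat) :
  ~ codim_ge S a n -> exists k, codim_eq S a k.
Proof.
  induction n as [|n IH]; intros H.
  - destruct H. intros p _ _. exact I.
  - destruct (classic (codim_ge S a n)); [exists n; split|]; auto.
Qed.

Lemma half_pow_lt (m n : nat) : m < n -> ((/ 2) ^ n < (/ 2) ^ m)%R.
Proof.
  intros H. rewrite !pow_inv. apply Rinv_lt_contravar.
  - apply Rmult_lt_0_compat; apply pow_lt; lra.
  - apply Rlt_pow; [lra | assumption].
Qed.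

Lemma half_pow_small (eps : R) : (0 < eps)%R -> exists n, ((/ 2) ^ n < eps)%R.
Proof.
  intros H. destruct (pow_lt_1_zero (/ 2)) with (y := eps) as [n Hn]; auto.
  - rewrite Rabs_right; lra.
  - exists n. specialize (Hn n (Nat.le_refl n)).
    rewrite Rabs_right in Hn; [exact Hn|]. apply Rle_ge. apply pow_le. lra.
Qed.

Lemma dist_codim_eq (a b : car S) (n : nat) :
  codim_eq S (symdiff a b) n -> Defs.dist S a b = ((/ 2) ^ n)%R.
Proof.
  intros [Hn Hn']. unfold Defs.dist. destruct excluded_middle_informative as [h | h].
  - destruct (constructive_indefinite_description _ h) as [k [Hk Hk']]; simpl.
    f_equal. destruct (Nat.lt_trichotomy k n) as [l | [l | l]]; [|exact l|].
    + destruct Hk'. apply codim_ge_le with n; auto.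
    + destruct Hn'. apply codim_ge_le with k; auto.
  - destruct h. exists n. split; assumption.
Qed.

Lemma dist_codim_infinite (a b : car S) :
  ~ (exists n, codim_eq S (symdiff a b) n) -> Defs.dist S a b = 0%R.
Proof.
  intros h. unfold Defs.dist.
  destruct excluded_middle_informative; [contradiction | reflexivity].
Qed.

(** The strict inequality shifts the index by one. Infinite codimension gives distance 0, and both
    sides hold. *)
Lemma dist_lt_half_pow (a b : car S) (n : nat) :
  (Defs.dist S a b < (/ 2) ^ n)%R <-> codim_ge S (symdiff a b) (Datatypes.S n).
Proof.
  destruct (classic (exists k, codim_eq S (symdiff a b) k)) as [[k Hk] | h].
  - rewrite (dist_codim_eq Hk). destruct Hk as [Hk Hk']. split; intros H.
    + apply codim_ge_le with k; [|assumption].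
      destruct (le_lt_dec (Datatypes.S n) k) as [l | l]; [exact l|]. exfalso.
      destruct (Nat.eq_dec k n) as [-> | ne]; [lra|].
      assert (l' : k < n) by lia. pose proof (half_pow_lt l'). lra.
    + apply half_pow_lt. destruct (le_lt_dec k n) as [l | l]; [|exact l].
      exfalso. apply Hk'. apply codim_ge_le with (Datatypes.S n); [lia | assumption].
  - rewrite (dist_codim_infinite h). split; intros H.
    + apply NNPP. intros k. apply h. exact (codim_exact k).
    + apply pow_lt. lra.
Qed.

Lemma codim_ge_of_dist_0 (a b : car S) (n : nat) :
  Defs.dist S a b = 0%R -> codim_ge S (symdiff a b) n.
Proof.
  intros H. apply codim_ge_le with (Datatypes.S n); [lia|].
  apply dist_lt_half_pow. rewrite H. apply pow_lt. lra.
Qed.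

End Height.

Lemma dist_eq_of_codim (S1 S2 : CHSig) (a b : car S1) (c d : car S2) :
  (forall n, codim_ge S1 (symdiff a b) n <-> codim_ge S2 (symdiff c d) n) ->
  Defs.dist S1 a b = Defs.dist S2 c d.
Proof.
  intros H.
  assert (E : forall n, codim_eq S1 (symdiff a b) n <-> codim_eq S2 (symdiff c d) n).
  { intros n. unfold codim_eq. rewrite !H. reflexivity. }
  destruct (classic (exists n, codim_eq S1 (symdiff a b) n)) as [[n Hn] | h].
  - rewrite (dist_codim_eq Hn). symmetry. apply dist_codim_eq. apply E. exact Hn.
  - rewrite !dist_codim_infinite; auto. intros [n Hn]. apply h. exists n. apply E. exact Hn.
Qed.

(** Counting step for chains of primes: [f] and [g] will be membership in two nested primes, [l] a
    list of representatives. *)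
Lemma filter_length_lt (A : Type) (f g : A -> bool) (l : list A) (x : A) :
  (forall y, f y = true -> g y = true) -> In x l -> f x = false -> g x = true ->
  length (filter f l) < length (filter g l).
Proof.
  intros fg Hx fx gx.
  assert (H : forall k, length (filter f k) <= length (filter g k)).
  { induction k as [|y k IH]; simpl; [lia|].
    destruct (f y) eqn:Ef; [rewrite (fg y Ef) | destruct (g y)]; simpl; lia. }
  induction l as [|y l IH]; [destruct Hx|]. simpl. destruct Hx as [-> | Hx].
  - rewrite fx, gx. simpl. specialize (H l). lia.
  - specialize (IH Hx).
    destruct (f y) eqn:Ef; [rewrite (fg y Ef) | destruct (g y)]; simpl; lia.
Qed.

(** * Generators of the ideals [dL] *)

Section PrincipalIdeals.

Variable S : CHSig.
Hypothesis HS : co_Heyting_order S.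

Local Ltac mm := auto 8 using mem_symdiff with coH.

Lemma dideal_iff (d : nat) (a : car S) : mem a ->
  (dideal S d a <-> forall p, prime_filter S p -> ~ height_ge S p d -> ~ p a).
Proof.
  intros Ha. split.
  - intros [_ h] p Hp Hd pa. exact (Hd (h p Hp pa)).
  - intros h. split; [assumption|]. intros p Hp pa. apply NNPP. intros k.
    exact (h p Hp k pa).
Qed.

(** A prime containing [symdiff a b] has below it a prime separating [a] and [b]; by monotonicity of
    height, if the former has height less than [d], so has the latter. *)
Lemma eqmod_iff (d : nat) (a b : car S) : mem a -> mem b ->
  (eqmod S d a b <->
   forall p, prime_filter S p -> ~ height_ge S p d -> (p a <-> p b)).
Proof.
  intros Ha Hb. unfold eqmod. rewrite dideal_iff by mm. split.
  - intros h p Hp Hd. apply NNPP. intros k. apply (h p Hp Hd).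
    apply prime_symdiff_iff; auto. exists p; auto.
  - intros h p Hp Hd k. apply prime_symdiff_iff in k; auto.
    destruct k as [q (Hq & qp & k)]. apply k. apply h; auto.
    intros l. apply Hd. apply height_ge_mono with q; auto.
Qed.

Lemma eqmod_refl (d : nat) (a : car S) : mem a -> eqmod S d a a.
Proof. intros Ha. apply eqmod_iff; auto. reflexivity. Qed.

Lemma eqmod_sym (d : nat) (a b : car S) : mem a -> mem b ->
  eqmod S d a b -> eqmod S d b a.
Proof.
  intros Ha Hb. rewrite !eqmod_iff by auto. intros h p Hp Hd. symmetry. auto.
Qed.

Lemma eqmod_trans (d : nat) (a b c : car S) : mem a -> mem b -> mem c ->
  eqmod S d a b -> eqmod S d b c -> eqmod S d a c.
Proof.
  intros Ha Hb Hc. rewrite !eqmod_iff by auto. intros h k p Hp Hd.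
  rewrite h by auto. auto.
Qed.

Lemma eqmod_le (m n : nat) (a b : car S) : m <= n -> eqmod S n a b -> eqmod S m a b.
Proof. intros Hmn [Hm H]. split; [assumption|]. apply codim_ge_le with n; auto. Qed.

Lemma dideal_eqmod (d : nat) (a b : car S) : mem a -> mem b ->
  eqmod S d a b -> dideal S d a -> dideal S d b.
Proof.
  intros Ha Hb. rewrite eqmod_iff, !dideal_iff by auto. intros h k p Hp Hd pb.
  apply (k p Hp Hd). apply h; auto.
Qed.

Lemma dideal_bot (d : nat) : dideal S d (bot S).
Proof.
  apply dideal_iff; [mm|]. intros p Hp _. apply Hp.
Qed.

Hypothesis Hfin : precompact S.

(** Take for [h] the meet of the representatives modulo [(d+1)L] that lie in [p]. A prime of height
    less than [d] containing [h] would contain all of [p], as each element of [p] is congruent to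
    such a representative, and would then have height at least [d]. *)
Lemma exact_height_meets_dideal (p : car S -> Prop) (d : nat) :
  prime_filter S p -> height_ge S p d -> ~ height_ge S p (Datatypes.S d) ->
  exists h, dideal S d h /\ p h.
Proof.
  intros Hp Hd Hd'.
  destruct (@Hfin (Datatypes.S d)) as [l [Hl Hcov]]; [lia|].
  assert (Hh : exists h, mem h /\ p h /\
    forall b, In b l -> p b -> forall q, prime_filter S q -> q h -> q b).
  { clear Hcov. induction l as [|c l IH].
    - exists (top S). split; [mm|]. split; [apply Hp|]. intros b [].
    - destruct IH as [h (Hh & ph & H)]. { intros b Hb. apply Hl. right; exact Hb. }
      assert (Hc : mem c) by (apply Hl; left; reflexivity).
      destruct (classic (p c)) as [pc | npc].
      + exists (meet c h). split; [mm|]. split; [apply prime_meet_iff; auto|].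
        intros b Hb pb q Hq qh. apply prime_meet_iff in qh; auto.
        destruct Hb as [<- | Hb]; [apply qh|]. apply H; tauto.
      + exists h. split; [assumption|]. split; [assumption|].
        intros b [<- | Hb] pb; [contradiction | exact (H b Hb pb)]. }
  destruct Hh as [h (Hh & ph & H)]. exists h. split; [|assumption].
  apply dideal_iff; auto. intros q Hq Hqd qh. apply Hqd.
  apply height_ge_mono with p; [|assumption]. intros c pc.
  assert (Hc : mem c) by (apply Hp; assumption).
  destruct (Hcov c Hc) as [b [Hb E]].
  rewrite eqmod_iff in E by auto.
  apply E; auto.
  - intros k. apply Hqd. apply height_ge_le with (Datatypes.S d); auto.
  - apply (H b); auto. apply E; auto.
Qed.

(** Take for [g] the join of the representatives modulo [(d+1)L] that lie in [dL]. The
    representative of an element of [dL] is again in [dL], because [(d+1)L] is contained in [dL]. *)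
Lemma dideal_generator_mod_succ (d : nat) :
  exists g, dideal S d g /\ forall a, dideal S d a ->
    forall p, prime_filter S p -> ~ height_ge S p (Datatypes.S d) -> p a -> p g.
Proof.
  destruct (@Hfin (Datatypes.S d)) as [l [Hl Hcov]]; [lia|].
  assert (Hg : exists g, dideal S d g /\ forall b, In b l -> dideal S d b ->
    forall p, prime_filter S p -> p b -> p g).
  { clear Hcov. induction l as [|c l IH].
    - exists (bot S). split; [apply dideal_bot|]. intros b [].
    - destruct IH as [g [Hg H]]. { intros b Hb. apply Hl. right; exact Hb. }
      assert (Hc : mem c) by (apply Hl; left; reflexivity).
      pose proof (proj1 Hg) as Mg.
      destruct (classic (dideal S d c)) as [dc | ndc].
      + exists (join c g). split.
        * rewrite dideal_iff in * by mm. intros p Hp Hd k.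
          apply prime_join_iff in k; auto. destruct k; [apply (dc p) | apply (Hg p)]; auto.
        * intros b [<- | Hb] db p Hp pb; apply prime_join_iff; auto.
          right. apply (H b); auto.
      + exists g. split; [assumption|]. intros b [<- | Hb] db; [contradiction | exact (H b Hb db)]. }
  destruct Hg as [g [Hg H]]. exists g. split; [assumption|].
  intros a Ha p Hp Hd pa. pose proof (proj1 Ha) as Ma.
  destruct (Hcov a Ma) as [b [Hb E]].
  apply (H b); auto.
  - apply dideal_eqmod with a; auto. apply eqmod_le with (Datatypes.S d); auto.
  - rewrite eqmod_iff in E by auto. apply E; auto.
Qed.

Hypothesis Hsep : hausdorff S.

(** If [sub a b] were nonzero, it would have finite codimension, hence lie in a prime of finite
    height; below that is a prime containing [a] and not [b], also of finite height. *)
Lemma le_of_finite_height_primes (a b : car S) : mem a -> mem b ->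
  (forall p n, prime_filter S p -> ~ height_ge S p n -> p a -> p b) -> le a b.
Proof.
  intros Ha Hb H.
  assert (E : eqv (sub a b) (bot S)).
  { apply NNPP. intros h. destruct (Hsep (mem_sub HS Ha Hb) h) as [n Hn].
    apply Hn. intros p Hp k. apply NNPP. intros Hpn.
    apply prime_sub_iff in k; auto. destruct k as [q (Hq & qp & qa & qb)].
    apply qb. apply (H q n); auto. intros l. apply Hpn. apply height_ge_mono with q; auto. }
  apply (le_trans HS) with (join b (sub a b)); mm.
  - apply (le_join_sub HS); mm.
  - apply (join_lub HS); mm. apply (le_trans HS) with (bot S); mm.
    apply (eqv_le HS); mm.
Qed.

(* The generator modulo [(d+1)L] lies in every prime of height exactly [d]; since primes of
   finite height separate points, it already generates [dL]. *)
Lemma dideal_principal (d : nat) : exists g, principal_gen S (dideal S d) g.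
Proof.
  destruct (dideal_generator_mod_succ d) as [g [Hg H]]. pose proof (proj1 Hg) as Mg.
  exists g. split; [assumption|]. intros a Ha. split.
  - intros Da. apply le_of_finite_height_primes; auto. intros q n Hq Hn qa.
    assert (Hqd : height_ge S q d) by (apply Da; auto).
    destruct (@subset_of_exact_height S q d n Hq Hn Hqd) as [r (Hr & rq & Hrd & Hrd')].
    (* The prime [r] need not contain [a]: it is the element [h] of [dL] that forces [g] into [r],
       hence into [q]. *)
    destruct (exact_height_meets_dideal Hr Hrd Hrd') as [h [Dh rh]].
    apply rq. apply (H h); auto.
  - intros Hag. split; [assumption|]. intros p Hp pa. apply Hg; [assumption|].
    apply (prime_up Hp Mg Hag pa).
Qed.

Lemma principal_gen_mem (d : nat) (g : car S) :
  principal_gen S (dideal S d) g -> dideal S d g.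
Proof. intros [Mg H]. apply H; mm. Qed.

(* A prime avoiding [g] is determined by its trace on representatives of the finite
   quotient [L/dL], so chains below it have bounded length. *)
Lemma finite_height_of_avoids_gen (d : nat) (g : car S) (p : car S -> Prop) : 1 <= d ->
  principal_gen S (dideal S d) g -> prime_filter S p -> ~ p g ->
  exists n, ~ height_ge S p n.
Proof.
  intros Hd1 Hg Hp Hpg. destruct (Hfin Hd1) as [l [Hl Hcov]].
  set (dec := fun (q : car S -> Prop) b =>
    if excluded_middle_informative (q b) then true else false).
  assert (bound : forall n q, prime_filter S q -> ~ q g -> height_ge S q n ->
    n <= length (filter (dec q) l)).
  { induction n as [|n IH]; intros q Hq Hqg H; [lia|].
    destruct H as [r (Hr & [rq [x [qx rx]]] & H)].
    assert (Hx : mem x) by (apply Hq; assumption).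
    assert (Hrg : ~ r g) by auto.
    specialize (IH r Hr Hrg H).
    (* Neither prime contains [g], so the representative [b] of [x] separates [r] from [q] just as
       [x] does. *)
    destruct (Hcov x Hx) as [b [Hb E]].
    assert (Hle : le (symdiff x b) g) by (apply Hg; [apply E | exact E]).
    enough (length (filter (dec r) l) < length (filter (dec q) l)) by lia.
    assert (Mb : mem b) by auto.
    pose proof (prime_congr HS Hr Hx Mb (proj1 Hg) Hle Hrg) as Er.
    pose proof (prime_congr HS Hq Hx Mb (proj1 Hg) Hle Hqg) as Eq.
    apply filter_length_lt with b; auto; unfold dec.
    - intros y. destruct excluded_middle_informative; [|discriminate].
      destruct excluded_middle_informative; [reflexivity|]. exfalso; auto.
    - destruct excluded_middle_informative; tauto.
    - destruct excluded_middle_informative; tauto. }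
  exists (Datatypes.S (length (filter (dec p) l))). intros k.
  specialize (bound _ p Hp Hpg k). lia.
Qed.

(** A prime avoiding [g] has finite height; if that height were at least [d], it would contain a
    prime of height exactly [d], which meets [dL] and so contains [g]. *)
Lemma prime_gen_iff_height (d : nat) (g : car S) (p : car S -> Prop) :
  principal_gen S (dideal S d) g -> prime_filter S p -> (p g <-> height_ge S p d).
Proof.
  intros Hg Hp. pose proof (principal_gen_mem Hg) as Dg. split; [apply Dg; assumption|].
  intros Hd. apply NNPP. intros Hpg.
  assert (exists n, ~ height_ge S p n) as [n Hn].
  (* Precompactness concerns positive [d] only; for [d = 0] the ideal is all of [L], so [g] lies in
     every prime. *)
  { destruct d as [|d].
    - exfalso. apply Hpg. apply (@prime_up S p (top S)); [assumption | exact (proj1 Hg) | | apply Hp].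
      exact (proj1 (proj2 Hg _ (mem_top HS)) (conj (mem_top HS) (fun q _ _ => I))).
    - apply finite_height_of_avoids_gen with (Datatypes.S d) g; auto. lia. }
  destruct (subset_of_exact_height Hp Hn Hd) as [r (Hr & rp & Hrd & Hrd')].
  destruct (exact_height_meets_dideal Hr Hrd Hrd') as [h [Dh rh]].
  apply Hpg. apply rp. apply (@prime_up S r h); [assumption | exact (proj1 Hg) | | assumption].
  exact (proj1 (proj2 Hg h (proj1 Dh)) Dh).
Qed.

(** A prime of finite height containing [g] contains one of height exactly [d], which has [g] but
    not [g']. Being an inequality between elements, this passes to the limit through [diag]. *)
Lemma gen_le_sub_gen_succ (d : nat) (g g' : car S) :
  principal_gen S (dideal S d) g -> principal_gen S (dideal S (Datatypes.S d)) g' ->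
  le g (sub g g').
Proof.
  intros Hg Hg'. pose proof (proj1 Hg). pose proof (proj1 Hg').
  apply le_of_finite_height_primes; mm. intros q n Hq Hn qg.
  pose proof (proj1 (prime_gen_iff_height Hg Hq) qg) as Hqd.
  destruct (subset_of_exact_height Hq Hn Hqd) as [r (Hr & rq & Hrd & Hrd')].
  apply prime_sub_iff; auto. exists r. split; [assumption|]. split; [assumption|]. split.
  - exact (proj2 (prime_gen_iff_height Hg Hr) Hrd).
  - rewrite (prime_gen_iff_height Hg' Hr). assumption.
Qed.

End PrincipalIdeals.

(** * The projective limit as a co-Heyting algebra *)

Section ProjectiveLimit.

Variable S : CHSig.
Hypothesis HS : co_Heyting_order S.

Local Ltac mm := auto 8 using mem_symdiff with coH.

Lemma hat_mem (x : car (hat S)) (d : nat) : mem x -> mem (x d).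
Proof. intros H. apply H. Qed.

Lemma hat_coherent (x : car (hat S)) (d n : nat) : mem x -> d <= n ->
  eqmod S d (x n) (x d).
Proof.
  intros Hx Hdn. induction Hdn as [|n Hdn IH].
  - apply eqmod_refl; auto. apply hat_mem; assumption.
  - apply eqmod_trans with (x n); auto using hat_mem.
    apply eqmod_le with n; [assumption|]. apply Hx.
Qed.

Lemma hat_prime_iff (x : car (hat S)) (d n : nat) (p : car S -> Prop) : mem x -> d <= n ->
  prime_filter S p -> ~ height_ge S p d -> (p (x n) <-> p (x d)).
Proof.
  intros Hx Hdn. apply eqmod_iff; auto using hat_mem. apply hat_coherent; assumption.
Qed.

(** The test on coordinate [d] involves only primes of [L] of height less than [d]; the order axioms
    of the limit are verified through it. *)
Lemma hat_le_iff (x y : car (hat S)) : mem x -> mem y ->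
  (le x y <-> forall d p, prime_filter S p -> ~ height_ge S p d -> p (x d) -> p (y d)).
Proof.
  intros Hx Hy.
  assert (E : forall d, eqmod S d (join (x d) (y d)) (y d) <->
    forall p, prime_filter S p -> ~ height_ge S p d -> p (x d) -> p (y d)).
  { intros d. pose proof (hat_mem d Hx). pose proof (hat_mem d Hy).
    rewrite eqmod_iff by mm. split.
    - intros h p Hp Hd px. apply h; auto. apply prime_join_iff; auto.
    - intros h p Hp Hd. rewrite prime_join_iff by auto. specialize (h p Hp Hd). tauto. }
  split; intros h d; apply E; apply h.
Qed.

Lemma hat_mem_iff (x : car (hat S)) : (forall d, mem (x d)) ->
  (forall d p, prime_filter S p -> ~ height_ge S p d -> (p (x (Datatypes.S d)) <-> p (x d))) ->
  mem x.
Proof. intros H h. split; [assumption|]. intros d. apply eqmod_iff; auto. Qed.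

Lemma hat_mem_op (op : car S -> car S -> car S) (x y : car (hat S)) :
  (forall a b, mem a -> mem b -> mem (op a b)) ->
  (forall d a b a' b', mem a -> mem b -> mem a' -> mem b' ->
     eqmod S d a a' -> eqmod S d b b' -> eqmod S d (op a b) (op a' b')) ->
  mem x -> mem y -> @mem (hat S) (fun d => op (x d) (y d)).
Proof.
  intros Hop Hc Hx Hy. split.
  - intros d. apply Hop; apply hat_mem; assumption.
  - intros d. apply Hc; auto using hat_mem; [apply Hx | apply Hy].
Qed.

Lemma eqmod_join (d : nat) (a b a' b' : car S) : mem a -> mem b -> mem a' -> mem b' ->
  eqmod S d a a' -> eqmod S d b b' -> eqmod S d (join a b) (join a' b').
Proof.
  intros Ha Hb Ha' Hb'. rewrite !eqmod_iff by mm. intros h k p Hp Hd.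
  rewrite !prime_join_iff, (h p Hp Hd), (k p Hp Hd) by auto. reflexivity.
Qed.

Lemma eqmod_meet (d : nat) (a b a' b' : car S) : mem a -> mem b -> mem a' -> mem b' ->
  eqmod S d a a' -> eqmod S d b b' -> eqmod S d (meet a b) (meet a' b').
Proof.
  intros Ha Hb Ha' Hb'. rewrite !eqmod_iff by mm. intros h k p Hp Hd.
  rewrite !prime_meet_iff, (h p Hp Hd), (k p Hp Hd) by auto. reflexivity.
Qed.

Lemma eqmod_sub (d : nat) (a b a' b' : car S) : mem a -> mem b -> mem a' -> mem b' ->
  eqmod S d a a' -> eqmod S d b b' -> eqmod S d (sub a b) (sub a' b').
Proof.
  intros Ha Hb Ha' Hb'. rewrite !eqmod_iff by mm. intros h k p Hp Hd.
  rewrite !prime_sub_iff by auto.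
  assert (Hq : forall q, (forall x, q x -> p x) -> ~ height_ge S q d).
  { intros q qp l. apply Hd. apply height_ge_mono with q; auto. }
  split; intros [q (Pq & qp & qa & qb)]; exists q;
    specialize (h q Pq (Hq q qp)); specialize (k q Pq (Hq q qp)); tauto.
Qed.

Lemma diag_mem (a : car S) : mem a -> @mem (hat S) (diag S a).
Proof. intros Ha. apply hat_mem_iff; intros; [exact Ha | reflexivity]. Qed.

(** For the difference, the witnesses given by [prime_sub_iff] lie below the prime being tested, so
    they stay in the range of heights seen by the coordinate. *)
Lemma hat_co_Heyting_order : co_Heyting_order (hat S).
Proof.
  assert (MJ : forall x y : car (hat S), mem x -> mem y -> mem (join x y)).
  { intros x y. apply hat_mem_op; [apply (mem_join HS) | apply eqmod_join]. }
  assert (MM : forall x y : car (hat S), mem x -> mem y -> mem (meet x y)).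
  { intros x y. apply hat_mem_op; [apply (mem_meet HS) | apply eqmod_meet]. }
  assert (MS : forall x y : car (hat S), mem x -> mem y -> mem (sub x y)).
  { intros x y. apply hat_mem_op; [apply (mem_sub HS) | apply eqmod_sub]. }
  assert (EJ : forall (x y : car (hat S)) d p, mem x -> mem y -> prime_filter S p ->
    (p (@join (hat S) x y d) <-> p (x d) \/ p (y d))).
  { intros x y d p Hx Hy Hp. apply prime_join_iff; auto using hat_mem. }
  assert (EM : forall (x y : car (hat S)) d p, mem x -> mem y -> prime_filter S p ->
    (p (@meet (hat S) x y d) <-> p (x d) /\ p (y d))).
  { intros x y d p Hx Hy Hp. apply prime_meet_iff; auto using hat_mem. }
  assert (ES : forall (x y : car (hat S)) d p, mem x -> mem y -> prime_filter S p ->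
    (p (@sub (hat S) x y d) <-> exists q, prime_filter S q /\ (forall a, q a -> p a) /\
       q (x d) /\ ~ q (y d))).
  { intros x y d p Hx Hy Hp. apply prime_sub_iff; auto using hat_mem. }
  assert (MB : @mem (hat S) (bot (hat S))) by (apply (@diag_mem (bot S)); mm).
  assert (MT : @mem (hat S) (top (hat S))) by (apply (@diag_mem (top S)); mm).
  assert (mono : forall d (p q : car S -> Prop), ~ height_ge S p d ->
    (forall a, q a -> p a) -> ~ height_ge S q d).
  { intros d p q Hd qp k. apply Hd. apply height_ge_mono with q; auto. }
  assert (LE : forall (x y : car (hat S)), mem x -> mem y -> le x y -> forall d p,
    prime_filter S p -> ~ height_ge S p d -> p (x d) -> p (y d)).
  { intros x y Hx Hy. apply hat_le_iff; assumption. }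
  constructor; auto; intros;
    try (apply hat_le_iff; auto 6; intros e p Hp Hd h).
  - apply (LE b c); auto. apply (LE a b); auto.
  - intros d. apply eqmod_iff; auto using hat_mem. intros p Hp Hd.
    split; [apply (LE a b) | apply (LE b a)]; auto.
  - exact (proj1 (proj1 (eqmod_iff HS e (hat_mem e H) (hat_mem e H0)) (H1 e) p Hp Hd) h).
  - destruct (proj1 (proj2 (proj2 Hp)) h).
  - apply Hp.
  - apply EJ; auto.
  - apply EJ; auto.
  - apply EJ in h; auto. destruct h; [apply (LE a c) | apply (LE b c)]; auto.
  - apply EM in h; auto. apply h.
  - apply EM in h; auto. apply h.
  - apply EM; auto. split; [apply (LE c a) | apply (LE c b)]; auto.
  - apply EM in h; auto. rewrite EJ in h by auto. rewrite EJ, !EM by auto. tauto.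
  - rewrite EJ, ES by auto. destruct (classic (p (b e))); [left; assumption|].
    right. exists p. auto.
  - apply ES in h; auto. destruct h as [q (Hq & qp & qa & qb)]. apply qp.
    apply (LE a (join b c)) with (d := e) (p := q) in qa; auto.
    + rewrite EJ in qa by auto. tauto.
    + apply mono with p; assumption.
Qed.

(** * Primes and codimension in the limit *)

Hypothesis Hfin : precompact S.
Hypothesis Hsep : hausdorff S.

Let HH := hat_co_Heyting_order.

(** One coordinate decides all: a prime tested at coordinate [n] and avoiding [g] has height less
    than both [n] and [d], so coherence identifies its values on [x n] and [x d]. *)
Lemma hat_le_gen_iff (d : nat) (g : car S) (x : car (hat S)) :
  principal_gen S (dideal S d) g -> mem x -> (le x (diag S g) <-> dideal S d (x d)).
Proof.
  intros Hg Hx. pose proof (proj1 Hg) as Mg. pose proof (hat_mem d Hx) as Mx.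
  pose proof (diag_mem Mg) as Dg.
  rewrite (hat_le_iff Hx Dg), (dideal_iff d Mx). split.
  - intros h p Hp Hd px. apply (h d p Hp Hd) in px. apply Hd.
    exact (proj1 (prime_gen_iff_height HS Hfin Hg Hp) px).
  - intros h n p Hp Hn px.
    apply (prime_gen_iff_height HS Hfin Hg Hp). apply NNPP. intros Hd.
    apply (h p Hp Hd). destruct (le_lt_dec d n) as [l | l].
    + apply (hat_prime_iff Hx l Hp Hd). exact px.
    + apply (hat_prime_iff Hx (Nat.lt_le_incl _ _ l) Hp Hn). exact px.
Qed.

Definition trace (P : car (hat S) -> Prop) : car S -> Prop :=
  fun a => mem a /\ P (diag S a).

Lemma diag_le (a b : car S) : mem a -> mem b -> le a b -> le (diag S a) (diag S b).
Proof.
  intros Ha Hb Hab. apply hat_le_iff; [apply diag_mem.. |]; auto.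
  intros d p Hp _ pa. exact (prime_up Hp Hb Hab pa).
Qed.

Lemma trace_prime (P : car (hat S) -> Prop) :
  prime_filter (hat S) P -> prime_filter S (trace P).
Proof.
  intros (_ & Pt & Pb & Pup & Pm & Pj).
  split; [|split; [|split; [|split; [|split]]]].
  - intros a h. apply h.
  - split; [mm | exact Pt].
  - intros [_ h]. exact (Pb h).
  - intros a b Hb [Ha h] Hab. split; [assumption|].
    apply (Pup (diag S a)); [apply diag_mem; assumption | assumption |].
    apply diag_le; assumption.
  - intros a b [Ha h] [Hb k]. split; [mm|]. exact (Pm _ _ h k).
  - intros a b Ha Hb [_ h].
    destruct (Pj (diag S a) (diag S b) (diag_mem Ha) (diag_mem Hb) h);
      [left | right]; split; assumption.
Qed.

(** When [p] has height less than [d] it is saturated modulo [dL]; this is then its pullback along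
    the projection of the limit onto [L/dL]. *)
Definition lift_prime (d : nat) (p : car S -> Prop) : car (hat S) -> Prop :=
  fun x => mem x /\ p (x d).

Lemma lift_prime_prime (d : nat) (p : car S -> Prop) :
  prime_filter S p -> ~ height_ge S p d -> prime_filter (hat S) (lift_prime d p).
Proof.
  intros Hp Hd. split; [|split; [|split; [|split; [|split]]]].
  - intros x h. apply h.
  - split; [apply (mem_top HH) | apply Hp].
  - intros [_ h]. apply Hp in h. exact h.
  - intros x y Hy [Hx px] Hxy. split; [assumption|].
    exact (proj1 (hat_le_iff Hx Hy) Hxy d p Hp Hd px).
  - intros x y [Hx px] [Hy py]. split; [apply (mem_meet HH); assumption|].
    exact (proj2 (prime_meet_iff HS Hp (hat_mem d Hx) (hat_mem d Hy)) (conj px py)).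
  - intros x y Hx Hy [_ h].
    destruct (proj1 (prime_join_iff HS Hp (hat_mem d Hx) (hat_mem d Hy)) h); [left | right]; split; assumption.
Qed.

(** [x] and [diag S (x d)] share their coordinate [d], so [hat_le_gen_iff] bounds their symmetric
    difference by [diag S g]. *)
Lemma prime_avoiding_gen_iff (d : nat) (g : car S) (P : car (hat S) -> Prop)
    (x : car (hat S)) :
  principal_gen S (dideal S d) g -> prime_filter (hat S) P -> ~ P (diag S g) -> mem x ->
  (P x <-> P (diag S (x d))).
Proof.
  intros Hg HP HPg Hx. pose proof (hat_mem d Hx) as Mx.
  pose proof (diag_mem Mx) as Dx. pose proof (diag_mem (proj1 Hg)) as Dg.
  apply (prime_congr HH HP Hx Dx Dg); [|assumption].
  apply (hat_le_gen_iff Hg); [apply mem_symdiff; assumption|].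
  exact (eqmod_refl HS d Mx).
Qed.

(** Strict inclusions survive: both primes avoid [diag S g], so an element [x] separating them can
    be replaced by its coordinate [x d]. *)
Lemma trace_height (d n : nat) (g : car S) (P : car (hat S) -> Prop) :
  principal_gen S (dideal S d) g -> prime_filter (hat S) P -> ~ P (diag S g) ->
  height_ge (hat S) P n -> height_ge S (trace P) n.
Proof.
  intros Hg. revert P. induction n as [|n IH]; intros P HP HPg H; [exact I|].
  destruct H as [Q (HQ & [QP [x [Px Qx]]] & H)].
  assert (HQg : ~ Q (diag S g)) by auto.
  assert (Hx : mem x) by (apply HP; assumption).
  apply height_ge_succ_of_subset with (q := trace Q) (x := x d).
  - apply trace_prime; assumption.
  - intros a [Ha h]. split; auto.
  - split; [apply hat_mem; assumption|].
    apply (prime_avoiding_gen_iff Hg HP HPg Hx). assumption.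
  - intros [_ h]. apply Qx. apply (prime_avoiding_gen_iff Hg HQ HQg Hx). assumption.
  - apply IH; assumption.
Qed.

(* Since [g_d - g_{d+1} = g_d] also holds in the limit, a prime containing [g_{d+1}] has
   strictly below it a prime containing [g_d]. *)
Lemma height_ge_of_gen (d : nat) (g : car S) (P : car (hat S) -> Prop) :
  principal_gen S (dideal S d) g -> prime_filter (hat S) P -> P (diag S g) ->
  height_ge (hat S) P d.
Proof.
  revert g P. induction d as [|d IH]; intros g P Hg HP Pg; [exact I|].
  (* Here [g] generates [(d+1)L] and [g'] generates [dL]; the chain [g <= g' <= sub g' g] puts the
     difference in [P]. *)
  destruct (dideal_principal HS Hfin Hsep d) as [g' Hg'].
  pose proof (proj1 Hg) as Mg. pose proof (proj1 Hg') as Mg'.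
  assert (Hle : le g g').
  { apply Hg'. { assumption. }
    split; [assumption|]. apply codim_ge_le with (Datatypes.S d); [lia|].
    apply (principal_gen_mem HS Hg). }
  assert (Hsub : P (diag S (sub g' g))).
  { refine (prime_up (a := diag S g) HP _ _ _).
    - apply diag_mem. mm.
    - refine (le_trans HH (b := diag S g') _ _ _ _ _); try apply diag_mem; mm.
      + apply diag_le; assumption.
      + apply diag_le; mm. apply (gen_le_sub_gen_succ HS Hfin Hsep Hg' Hg).
    - assumption. }
  apply (prime_sub_iff HH HP (diag_mem Mg') (diag_mem Mg)) in Hsub.
  destruct Hsub as [Q (HQ & QP & Qg' & Qg)].
  apply height_ge_succ_of_subset with (q := Q) (x := diag S g); auto.
  apply IH with g'; assumption.
Qed.

(** If a prime [p] of height less than [d] contained [x d], its lift would contain [x], hence have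
    height at least [d], and so would its trace, which lies in [p]. Conversely [x] is below
    [diag S g], and [height_ge_of_gen] applies. *)
Lemma hat_codim_iff (d : nat) (x : car (hat S)) : mem x ->
  (codim_ge (hat S) x d <-> dideal S d (x d)).
Proof.
  intros Hx. destruct (dideal_principal HS Hfin Hsep d) as [g Hg].
  pose proof (proj1 Hg) as Mg. split.
  - intros h. apply dideal_iff; [apply hat_mem; assumption|]. intros p Hp Hd px.
    pose proof (lift_prime_prime Hp Hd) as HP.
    assert (HPg : ~ lift_prime d p (diag S g)).
    { intros [_ k]. apply Hd. exact (proj1 (prime_gen_iff_height HS Hfin Hg Hp) k). }
    apply Hd. apply height_ge_mono with (trace (lift_prime d p)).
    + intros a [_ [_ k]]. exact k.
    + apply (trace_height Hg HP HPg). apply h; [assumption|]. split; assumption.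
  - intros Dx P HP Px. apply (height_ge_of_gen Hg HP).
    refine (prime_up (a := x) HP _ _ _); [apply diag_mem; assumption | | assumption].
    apply (hat_le_gen_iff Hg Hx). assumption.
Qed.

Lemma hat_dideal_iff (d : nat) (x : car (hat S)) : mem x ->
  (dideal (hat S) d x <-> dideal S d (x d)).
Proof. intros Hx. rewrite <- hat_codim_iff by assumption. unfold dideal. tauto. Qed.

Lemma hat_eqmod_iff (d : nat) (x y : car (hat S)) : mem x -> mem y ->
  (eqmod (hat S) d x y <-> eqmod S d (x d) (y d)).
Proof. intros Hx Hy. apply hat_dideal_iff. apply mem_symdiff; assumption. Qed.

Lemma hat_dist_lt_half_pow (x y : car (hat S)) (n : nat) : mem x -> mem y ->
  ((Defs.dist (hat S) x y < (/ 2) ^ n)%R <->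
   eqmod S (Datatypes.S n) (x (Datatypes.S n)) (y (Datatypes.S n))).
Proof.
  intros Hx Hy. rewrite dist_lt_half_pow.
  apply hat_codim_iff. apply mem_symdiff; assumption.
Qed.

(** * Generators, closures, quotients and topology of the limit *)

Lemma hat_principal_gen (d : nat) (g : car S) :
  principal_gen S (dideal S d) g -> principal_gen (hat S) (dideal (hat S) d) (diag S g).
Proof.
  intros Hg. split; [exact (diag_mem (proj1 Hg))|]. intros x Hx.
  rewrite (hat_dideal_iff d Hx), (hat_le_gen_iff Hg Hx). reflexivity.
Qed.

Lemma closure_dideal_iff (d : nat) (x : car (hat S)) : mem x ->
  (proj_closure_img (dideal S d) x <-> dideal (hat S) d x).
Proof.
  intros Hx. rewrite (hat_dideal_iff d Hx). pose proof (hat_mem d Hx) as Mx. split.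
  - intros h. destruct (h d) as [a [Da E]].
    refine (dideal_eqmod HS (a := a) _ _ _ _); [apply Da | assumption | apply E; lia | assumption].
  (* The index must reach [n] to approximate the coordinates up to [n], and [d] for the element to
     lie in [dL]. *)
  - intros Dx n. exists (x (max n d)). split.
    + refine (dideal_eqmod HS (a := x d) _ _ _ _); auto using hat_mem.
      apply eqmod_sym; auto using hat_mem. apply hat_coherent; [assumption | lia].
    + intros k Hk. apply hat_coherent; [assumption | lia].
Qed.

(** Surjectivity: [y] is congruent to the constant sequence at [y d]. The operations commute with
    [diag] by computation. *)
Lemma diag_quot_iso (d : nat) :
  is_iso (quot S (dideal S d)) (quot (hat S) (dideal (hat S) d)) (diag S).
Proof.
  assert (R : forall a, mem a -> eqmod (hat S) d (diag S a) (diag S a)).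
  { intros a Ha. exact (proj2 (hat_eqmod_iff d (diag_mem Ha) (diag_mem Ha)) (eqmod_refl HS d Ha)). }
  split; [|split; [|split; [|split; [|split]]]].
  - apply diag_mem.
  - intros a b Ha Hb. exact (hat_eqmod_iff d (diag_mem Ha) (diag_mem Hb)).
  - intros y Hy. pose proof (hat_mem d Hy) as My. exists (y d). split; [assumption|].
    exact (proj2 (hat_eqmod_iff d (diag_mem My) Hy) (eqmod_refl HS d My)).
  - intros a b Ha Hb. split; [|split].
    + exact (R _ (mem_join HS Ha Hb)).
    + exact (R _ (mem_meet HS Ha Hb)).
    + exact (R _ (mem_sub HS Ha Hb)).
  - exact (R _ (mem_bot HS)).
  - exact (R _ (mem_top HS)).
Qed.

(** The ball of radius [(/ 2) ^ n] is cut out by coordinate [n + 1] alone, which by coherence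
    controls all earlier coordinates. *)
Lemma proj_open_iff_dist_open (U : car (hat S) -> Prop) : proj_open U <-> dist_open U.
Proof.
  split; intros h x Hx Ux.
  - destruct (h x Hx Ux) as [n Hn]. exists ((/ 2) ^ n)%R. split; [apply pow_lt; lra|].
    intros y Hy Hd. apply hat_dist_lt_half_pow in Hd; auto. apply Hn; [assumption|].
    intros k Hk. assert (k <= Datatypes.S n) by lia.
    refine (eqmod_trans HS (b := y (Datatypes.S n)) _ _ _ _ _); auto using hat_mem.
    { apply eqmod_sym; auto using hat_mem. apply hat_coherent; assumption. }
    refine (eqmod_trans HS (b := x (Datatypes.S n)) _ _ _ _ _); auto using hat_mem.
    { apply eqmod_sym; auto using hat_mem. apply eqmod_le with (Datatypes.S n); assumption. }
    apply hat_coherent; assumption.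
  - destruct (h x Hx Ux) as [eps [He Hn]]. destruct (half_pow_small He) as [n Hsmall].
    exists (Datatypes.S n). intros y Hy E. apply Hn; [assumption|].
    apply Rlt_trans with ((/ 2) ^ n)%R; [|assumption].
    apply hat_dist_lt_half_pow; auto. apply eqmod_sym; auto using hat_mem.
Qed.

(** Coordinate [n] of a Cauchy sequence is eventually constant modulo [nL]; the limit collects these
    eventual values. *)
Lemma hat_complete (s : nat -> car (hat S)) :
  (forall n, mem (s n)) -> cauchy (hat S) s ->
  exists x, @mem (hat S) x /\ converges_to (hat S) s x.
Proof.
  intros Hs Hc.
  assert (HN : forall n, exists N, forall k l, N <= k -> N <= l ->
    eqmod S n (s k n) (s l n)).
  { intros n. destruct (Hc ((/ 2) ^ n)%R) as [N HN]; [apply pow_lt; lra|].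
    exists N. intros k l Hk Hl. specialize (HN k l Hk Hl).
    apply dist_lt_half_pow in HN. apply (codim_ge_le (Nat.le_succ_diag_r n)) in HN.
    apply hat_codim_iff in HN; [exact HN|]. apply mem_symdiff; auto. }
  set (N := fun n => proj1_sig (constructive_indefinite_description _ (HN n))).
  assert (HN' : forall n k l, N n <= k -> N n <= l -> eqmod S n (s k n) (s l n)).
  { intros n. exact (proj2_sig (constructive_indefinite_description _ (HN n))). }
  assert (M : forall k n, mem (s k n)) by (intros; apply hat_mem; auto).
  set (x := fun n => s (N n) n).
  exists x. assert (Hx : @mem (hat S) x).
  { split; [intros n; apply M|]. intros n. unfold x.
    (* The thresholds [N] need not be monotone, so the comparison goes through an index beyond
       both. *)
    set (k := max (N n) (N (Datatypes.S n))).
    refine (eqmod_trans HS (b := s k (Datatypes.S n)) _ _ _ _ _); auto.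
    { apply eqmod_le with (Datatypes.S n); [lia|]. apply HN'; lia. }
    refine (eqmod_trans HS (b := s k n) _ _ _ _ _); auto.
    { apply hat_coherent; [auto | lia]. }
    apply HN'; lia. }
  split; [assumption|]. intros eps He. destruct (half_pow_small He) as [n Hn].
  exists (N (Datatypes.S n)). intros k Hk. apply Rlt_trans with ((/ 2) ^ n)%R; [|assumption].
  apply hat_dist_lt_half_pow; auto. apply HN'; lia.
Qed.

Lemma symdiff_eqv (a b : car S) : mem a -> mem b ->
  (forall n, codim_ge S (symdiff a b) n) -> eqv a b.
Proof.
  intros Ha Hb h.
  assert (E : forall n p, prime_filter S p -> ~ height_ge S p n -> (p a <-> p b)).
  { intros n. apply eqmod_iff; auto. split; [apply mem_symdiff|]; auto. }
  apply (le_antisym HS); auto; apply (le_of_finite_height_primes HS); auto;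
    intros p n Hp Hn; apply (E n p Hp Hn).
Qed.

Lemma diag_completion : is_completion_via_diag S.
Proof.
  split; [|split; [|split; [|split; [|split]]]].
  - intros a b Ha Hb h. apply symdiff_eqv; auto. intros n. apply codim_ge_of_dist_0; assumption.
  - intros x y Hx Hy h d. apply (hat_eqmod_iff d Hx Hy). split.
    + apply mem_symdiff; assumption.
    + apply codim_ge_of_dist_0; assumption.
  - apply diag_mem.
  - intros a b Ha Hb. apply dist_eq_of_codim. intros n.
    rewrite hat_codim_iff by (apply mem_symdiff; auto using diag_mem).
    split; [intros h; apply h|]. intros h. split; [|assumption]. apply mem_symdiff; assumption.
  - intros x Hx eps He. destruct (half_pow_small He) as [n Hn].
    pose proof (hat_mem (Datatypes.S n) Hx) as Mx.
    (* Coordinate [n + 1] is the one that decides the ball of radius [(/ 2) ^ n]. *)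
    exists (x (Datatypes.S n)). split; [assumption|].
    apply Rlt_trans with ((/ 2) ^ n)%R; [|assumption].
    apply hat_dist_lt_half_pow; auto using diag_mem. apply eqmod_refl; assumption.
  - apply hat_complete.
Qed.

End ProjectiveLimit.

(** * From the equational axioms to the theorem *)

Lemma CHofType_co_Heyting_order (T : Type) (j m s : T -> T -> T) (b t : T) :
  is_coHeyting (CHofType j m s b t) -> co_Heyting_order (CHofType j m s b t).
Proof.
  intros (_ & _ & _ & _ & _ & _ & _ & Hcomm & Hassoc & Habs & Hunit & Hdistr & Hsub).
  cbv [le CHofType Defs.join Defs.meet Defs.sub bot top mem eqv car] in *.
  assert (jC : forall x y, j x y = j y x) by (intros; apply Hcomm; exact I).
  assert (mC : forall x y, m x y = m y x) by (intros; apply Hcomm; exact I).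
  assert (jA : forall x y z, j x (j y z) = j (j x y) z) by (intros; apply Hassoc; exact I).
  assert (mA : forall x y z, m x (m y z) = m (m x y) z) by (intros; apply Hassoc; exact I).
  assert (jK : forall x y, j x (m x y) = x) by (intros; apply Habs; exact I).
  assert (mK : forall x y, m x (j x y) = x) by (intros; apply Habs; exact I).
  assert (j0 : forall x, j x b = x) by (intros; apply Hunit; exact I).
  assert (m1 : forall x, m x t = x) by (intros; apply Hunit; exact I).
  assert (dist : forall x y z, m x (j y z) = j (m x y) (m x z))
    by (intros; apply Hdistr; exact I).
  assert (jj : forall x, j x x = x).
  { intros x. rewrite <- (mK x x) at 2. apply jK. }
  (* The order is defined by joins; this gives its description by meets, needed for greatest lower
     bounds. *)
  assert (jm : forall x y, j x y = y <-> m x y = x).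
  { intros x y. split; intros <-; [apply mK | rewrite jC, mC; apply jK]. }
  constructor; cbv [le CHofType Defs.join Defs.meet Defs.sub bot top mem eqv car];
    try (intros; exact I).
  - intros x _. apply jj.
  - intros x y z _ _ _ h k. rewrite <- k, jA, h. reflexivity.
  - intros x y _ _ h k. rewrite <- h, jC. symmetry. exact k.
  - intros x y _ _ ->. apply jj.
  - intros x _. rewrite jC. apply j0.
  - intros x _. apply jm. apply m1.
  - intros x y _ _. rewrite jA, jj. reflexivity.
  - intros x y _ _. rewrite (jC x), jA, jj. reflexivity.
  - intros x y z _ _ _ h k. rewrite <- jA, k. exact h.
  - intros x y _ _. rewrite jC. apply jK.
  - intros x y _ _. rewrite jC, mC. apply jK.
  - intros x y z _ _ _ h k. apply jm. apply jm in h, k. rewrite mA, h. exact k.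
  - intros x y z _ _ _. rewrite dist. apply jj.
  - intros x y _ _. apply Hsub; exact I.
  - intros x y z _ _ _. apply Hsub; exact I.
Qed.

Theorem theorem6p1 (T : Type) (j m s : T -> T -> T) (b t : T) :
  let L := CHofType j m s b t in
  is_coHeyting L -> hausdorff L -> precompact L ->
  (forall d, 1 <= d ->
     (* (1) dL, d\hat L principal, with the same generator *)
     (exists g, principal_gen L (dideal L d) g /\
                principal_gen (hat L) (dideal (hat L) d) (diag L g)) /\
     (* (2) closure of dL in \hat L is d\hat L *)
     (forall x, @mem (hat L) x ->
        (proj_closure_img (dideal L d) x <-> dideal (hat L) d x)) /\
     (* (2) L/dL ≅ \hat L/d\hat L induced by the inclusion *)
     is_iso (quot L (dideal L d)) (quot (hat L) (dideal (hat L) d)) (diag L)) /\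
  (* projective topology = codimetric topology on \hat L *)
  (forall U : car (hat L) -> Prop, proj_open U <-> dist_open U) /\
  (* (\hat L, dist) is the completion of (L, dist) *)
  is_completion_via_diag L.
Proof.
  intros L HL Hsep Hfin. pose proof (CHofType_co_Heyting_order HL) as HS.
  split; [|split].
  - intros d _. split; [|split].
    + destruct (dideal_principal HS Hfin Hsep d) as [g Hg].
      exists g. split; [assumption|]. exact (hat_principal_gen HS Hfin Hsep Hg).
    + intros x Hx. exact (closure_dideal_iff HS Hfin Hsep d Hx).
    + exact (diag_quot_iso HS Hfin Hsep d).
  - exact (proj_open_iff_dist_open HS Hfin Hsep).
  - exact (diag_completion HS Hfin Hsep).
Qed.
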